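(* Let $X\in\mathcal{B}_{\mathbf{l}}^{\boldsymbol\alpha}([0,1]^d,c(\cdot))$ be a locally stationary random field, approximated by the multivariate piecewise linear interpolator $X_N(X,T_N)$, where $T_N$ is a $cRS(h,\pi,\mathbf{l})$ sequence of designs with $h=(h_1,\ldots,h_k)$. For $j=1,\ldots,k$ put $H_j(\mathbf{t}^j):=(1/h_j(t_{L_{j-1}+1}),\ldots,1/h_j(t_{L_j}))$ and $$v_j:=\int_{[0,1]^d} c_j(\mathbf{t})\,b_{\alpha_j,l_j}(H_j(\mathbf{t}^j))\,d\mathbf{t}.$$ If $l_j=1$ for some $j$, $1\le j\le k$, then for any positive continuous density $h_j(\cdot)$ on $[0,1]$, $$v_j=a_{\alpha_j}\int_0^1 C_j(t_{L_j})\,h_j(t_{L_j})^{-\alpha_j}\,dt_{L_j}.$$ The density minimizing $v_j$ (among positive continuous densities on $[0,1]$) is given by $$h_{j,opt}(t_{L_j})=\frac{C_j(t_{L_j})^{\gamma_j}}{\int_0^1C_j(\tau_{L_j})^{\gamma_j}\,d\tau_{L_j}},\quad t_{L_j}\in[0,1],$$ where $\gamma_j:=1/(1+\alpha_j)$. Furthermore, for this choice of density, $v_j$ equals $$v_{j,opt}=a_{\alpha_j}\|C_j\|_{\gamma_j}.$$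
   Context: Random fields: $X=X(\mathbf{t})$, $\mathbf{t}\in[0,1]^d$, is a real-valued random field with $\mathrm{E}X(\mathbf{t})^2<\infty$ for all $\mathbf{t}$. For a random variable $\xi$ put $\|\xi\|:=(\mathrm{E}\xi^2)^{1/2}$; for vectors, $\|\cdot\|$ is the Euclidean norm. $\mathcal{C}([0,1]^d)$ is the space of quadratic mean (q.m.) continuous random fields, i.e. those for which $\mathbf{t}\mapsto X(\mathbf{t})\in L^2(\Omega)$ is continuous. Decomposition: $k\le d$, $\mathbf{l}=(l_1,\ldots,l_k)$ is a vector of positive integers with $\sum_{j=1}^k l_j=d$, $L_0=0$, $L_i=\sum_{j=1}^i l_j$. For $\mathbf{s}\in\mathbb{R}^d$, $\mathbf{s}^j:=(s_{L_{j-1}+1},\ldots,s_{L_j})$, $j=1,\ldots,k$. $\boldsymbol\alpha=(\alpha_1,\ldots,\alpha_k)$ with $0<\alpha_j<2$. Local stationarity: $X\in\mathcal{B}_{\mathbf{l}}^{\boldsymbol\alpha}([0,1]^d,c(\cdot))$ means that $X\in\mathcal{C}([0,1]^d)$ and, for positive continuous functions $c_1,\ldots,c_k$ on $[0,1]^d$, $c=(c_1,\ldots,c_k)$, $$\frac{\|X(\mathbf{t}+\mathbf{s})-X(\mathbf{t})\|^2}{\sum_{j=1}^k c_j(\mathbf{t})\|\mathbf{s}^j\|^{\alpha_j}}\to1\quad\text{as }\mathbf{s}\to0\ (\mathbf{s}\ne0,\ \mathbf{t}+\mathbf{s}\in[0,1]^d),\text{ uniformly in }\mathbf{t}\in[0,1]^d;$$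 moreover each $c_j(\cdot)$ is invariant under permutations of the coordinates $t_{L_{j-1}+1},\ldots,t_{L_j}$ of the $j$-th component. The integrated local stationarity functions are $$C_j(t_{L_j}):=\int_{[0,1]^{d-1}}c_j(\mathbf{t})\,dt_1\cdots dt_{L_j-1}\,dt_{L_j+1}\cdots dt_d,\quad t_{L_j}\in[0,1],\ j=1,\ldots,k.$$ For $0<\beta<2$, $a_\beta:=\frac{2}{(\beta+1)(\beta+2)}-\frac16$. For a positive continuous function $f$ on $[0,1]$ and $\gamma>0$ (possibly $\gamma<1$), $\|f\|_\gamma:=\left(\int_0^1f(t)^\gamma dt\right)^{1/\gamma}$. Designs: $h_1,\ldots,h_k$ are positive continuous probability densities on $[0,1]$, not depending on $N$. $N$ ranges over an infinite set of positive integers, and for each such $N$, $\pi(N)=(n_1,\ldots,n_k)$ is a vector of positive integers with $\prod_{j=1}^k(n_j+1)^{l_j}=N$ and $n_j=n_j(N)\to\infty$ as $N\to\infty$ for each $j$. For $i=L_{j-1}+1,\ldots,L_j$ put $h_i^*:=h_j$, $n_i^*:=n_j$. The design $T_N$ is $cRS(h,\pi,\mathbf{l})$ (cross regular sequence) if $T_N=\{\mathbf{t}_{\mathbf{i}}=(t_{1,i_1},\ldots,t_{d,i_d}):0\le i_m\le n_m^*,\ m=1,\ldots,d\}$, where $\int_0^{t_{m,i}}h_m^*(v)\,dv=i/n_m^*$, $i=0,\ldots,n_m^*$. Interpolator: let $*$ denote coordinatewise multiplication. For $\mathbf{i}$ with $0\le i_m\le n_m^*-1$ let $\mathbf{r}_{\mathbf{i}}=\mathbf{t}_{\mathbf{i}+(1,\ldots,1)}-\mathbf{t}_{\mathbf{i}}$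 and $\mathcal{D}_{\mathbf{i}}=\{\mathbf{t}_{\mathbf{i}}+\mathbf{r}_{\mathbf{i}}*\mathbf{s}:\mathbf{s}\in[0,1]^d\}$. The multivariate piecewise linear interpolator (MPLI) is $X_N(\mathbf{t}):=\mathrm{E}_{\boldsymbol\eta}X(\mathbf{t}_{\mathbf{i}}+\mathbf{r}_{\mathbf{i}}*\boldsymbol\eta)$ for $\mathbf{t}=\mathbf{t}_{\mathbf{i}}+\mathbf{r}_{\mathbf{i}}*\mathbf{s}\in\mathcal{D}_{\mathbf{i}}$, where $\boldsymbol\eta=(\eta_1,\ldots,\eta_d)$ has independent Bernoulli components with means $s_1,\ldots,s_d$, auxiliary to $X$, and $\mathrm{E}_{\boldsymbol\eta}$ is expectation over $\boldsymbol\eta$ only; i.e. $X_N(\mathbf{t})=\sum_{\mathbf{e}\in\{0,1\}^d}X(\mathbf{t}_{\mathbf{i}}+\mathbf{r}_{\mathbf{i}}*\mathbf{e})\prod_{m=1}^d s_m^{e_m}(1-s_m)^{1-e_m}$. The constant $b_{\beta,m}$: for $0<\beta<2$ and $m\in\mathbb{N}$, $B_{\beta,m}(\mathbf{t})$, $\mathbf{t}\in\mathbb{R}_+^m$, is the (zero mean) fractional Brownian field with covariance $r(\mathbf{t},\mathbf{s})=\frac12(\|\mathbf{t}\|^\beta+\|\mathbf{s}\|^\beta-\|\mathbf{t}-\mathbf{s}\|^\beta)$. For $\mathbf{u}\in\mathbb{R}_+^m$ (positive coordinates), $$b_{\beta,m}(\mathbf{u}):=\int_{[0,1]^m}\left\|B_{\beta,m}(\mathbf{u}*\mathbf{s})-\mathrm{E}_{\boldsymbol\eta}B_{\beta,m}(\mathbf{u}*\boldsymbol\eta)\right\|^2d\mathbf{s},$$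 where $\boldsymbol\eta=(\eta_1,\ldots,\eta_m)$ has independent Bernoulli components with means $s_1,\ldots,s_m$, and $\mathrm{E}_{\boldsymbol\eta}$ is expectation over $\boldsymbol\eta$ only. *)

(* Defs.v *)
From HB Require Import structures.
From mathcomp Require Import all_boot all_order all_algebra all_fingroup.
From mathcomp Require Import all_classical all_reals all_analysis.

Set Implicit Arguments.
Unset Strict Implicit.
Unset Printing Implicit Defensive.

Import Order.TTheory GRing.Theory Num.Theory.
Import numFieldNormedType.Exports.

Local Open Scope classical_set_scope.
Local Open Scope ring_scope.

Section measurable_row.
Context {R : realType} {n : nat}.

Let coord (i : 'I_n) (x : 'rV[R]_n) : R := x 0 i.

Let row_set0 : g_sigma_preimage coord set0.
Proof. exact: sigma_algebra0. Qed.

Let row_setC A : g_sigma_preimage coord A -> g_sigma_preimage coord (~` A).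
Proof. exact: sigma_algebraC. Qed.

Let row_bigcup (F : (set 'rV[R]_n)^nat) :
  (forall i, g_sigma_preimage coord (F i)) ->
  g_sigma_preimage coord (\bigcup_i (F i)).
Proof. exact: sigma_algebra_bigcup. Qed.

(* the sigma-algebra generated by the coordinates, i.e. the Borel sets *)
HB.instance Definition _ := @isMeasurable.Build default_measure_display
  'rV[R]_n (g_sigma_preimage coord) row_set0 row_setC row_bigcup.

Lemma measurable_coord (i : 'I_n) :
  measurable_fun [set: 'rV[R]_n] (fun x : 'rV[R]_n => x 0 i).
Proof.
move=> _ Y mY; rewrite setTI; apply: sub_sigma_algebra => /=.
rewrite -bigcup_seq/=; exists i => /=; first by rewrite mem_index_enum.
by exists Y => //; rewrite setTI.
Qed.

Lemma measurable_rowP d (T : measurableType d) (f : T -> 'rV[R]_n) :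
  (forall i, measurable_fun [set: T] (fun x => f x 0 i)) ->
  measurable_fun [set: T] f.
Proof.
move=> mf _ Y mY; rewrite setTI.
have -> : f @^-1` Y = [set: T] `&` f @^-1` Y by rewrite setTI.
suff : g_sigma_preimage coord `<=`
    image_set_system setT f (@measurable _ T) by exact.
apply: smallest_sub; first exact/sigma_algebra_image/sigma_algebra_measurable.
rewrite -bigcup_seq => A [i _ [B mB <-]].
by rewrite /image_set_system /= !setTI -comp_preimage -[X in measurable X]setTI;
  exact: mf.
Qed.

End measurable_row.

(* the vector of [R^n] whose coordinate [p] is [x] and whose other
   coordinates are, in order, those of [y] *)
Definition insert {R : realType} (n : nat) (p : 'I_n) (x : R)
    (y : 'rV[R]_n.-1) : 'rV[R]_n :=
  \row_i (if unlift p i is Some q then y 0 q else x).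

Section lebesgue_row.
Context {R : realType}.

Lemma measurable_insert n (p : 'I_n) : measurable_fun
  [set: R * 'rV[R]_n.-1] (fun z : R * 'rV[R]_n.-1 => insert p z.1 z.2).
Proof.
apply: measurable_rowP => i; rewrite /insert.
under eq_fun do rewrite mxE.
case: (unlift p i) => [q|]; last exact: measurable_fst.
exact: (measurableT_comp (measurable_coord q) measurable_snd).
Qed.

Section step.
Variables (n : nat) (mu : {sigma_finite_measure set 'rV[R]_n -> \bar R}).

Let cons_row (z : R * 'rV[R]_n) : 'rV[R]_n.+1 := insert ord0 z.1 z.2.

Let mcons_row : measurable_fun [set: R * 'rV[R]_n] cons_row.
Proof. exact: (@measurable_insert n.+1 ord0). Qed.

Definition lebesgue_step : set 'rV[R]_n.+1 -> \bar R :=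
  pushforward (@lebesgue_measure R \x mu)%E cons_row.

Let lebesgue_step0 : lebesgue_step set0 = 0%E.
Proof. exact: measure0. Qed.

Let lebesgue_step_ge0 A : (0 <= lebesgue_step A)%E.
Proof. exact: measure_ge0. Qed.

Let lebesgue_step_sigma_additive : semi_sigma_additive lebesgue_step.
Proof. exact: measure_semi_sigma_additive. Qed.

HB.instance Definition _ := isMeasure.Build _ _ _ lebesgue_step
  lebesgue_step0 lebesgue_step_ge0 lebesgue_step_sigma_additive.

Let lebesgue_step_sigma_finite : sigma_finite [set: 'rV[R]_n.+1] lebesgue_step.
Proof.
have /sigma_finiteP[F [TF ndF Foo]] := sigma_finiteT (@lebesgue_measure R).
have /sigma_finiteP[G [TG ndG Goo]] := sigma_finiteT mu.
pose uncons (x : 'rV[R]_n.+1) : R * 'rV[R]_n :=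
  (x 0 ord0, \row_q x 0 (lift ord0 q)).
have uncons_row z : uncons (cons_row z) = z.
  case: z => x y; rewrite /uncons /cons_row /insert /= mxE unlift_none.
  by congr pair; apply/rowP => q; rewrite !mxE liftK.
have muncons : measurable_fun [set: 'rV[R]_n.+1] uncons.
  apply/measurable_fun_pairP; split => /=; first exact: measurable_coord.
  apply: measurable_rowP => i /=; under eq_fun do rewrite mxE.
  exact: measurable_coord.
exists (fun i => uncons @^-1` (F i `*` G i)).
  rewrite predeqE => x; split=> // _.
  have [i _ Fi] : (\bigcup_i F i) (uncons x).1 by rewrite -TF.
  have [j _ Gj] : (\bigcup_i G i) (uncons x).2 by rewrite -TG.
  exists (maxn i j) => //; split.
  - by move: Fi; exact/subsetPset/ndF/leq_maxl.
  - by move: Gj; exact/subsetPset/ndG/leq_maxr.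
move=> i; have [mF Fi] := Foo i; have [mG Gi] := Goo i; split.
  by rewrite -[X in measurable X]setTI; apply: muncons => //; exact: measurableX.
rewrite /lebesgue_step /pushforward -comp_preimage.
rewrite (_ : uncons \o cons_row = id); last exact/funext.
by rewrite preimage_id product_measure1E// lte_mul_pinfty// ge0_fin_numE.
Qed.

HB.instance Definition _ := Measure_isSigmaFinite.Build _ _ _ lebesgue_step
  lebesgue_step_sigma_finite.
End step.

Fixpoint lebesgue_row (n : nat) :
    {sigma_finite_measure set 'rV[R]_n -> \bar R} :=
  if n is m.+1 then lebesgue_step (lebesgue_row m) else \d_(0 : 'rV[R]_0).

End lebesgue_row.

Lemma lebesgue_row_box (R : realType) (n : nat)
    (A : 'I_n -> set (measurableTypeR R)) :
  (forall i, measurable (A i)) ->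
  lebesgue_row n [set x : 'rV[R]_n | forall i, A i (x 0 i)] =
  (\prod_(i < n) lebesgue_measure (A i))%E.
Proof.
elim: n A => [|n IHn] A mA /=.
  rewrite big_ord0 (_ : [set _ | _] = setT) ?diracT//.
  by rewrite predeqE => x; split=> // _ [].
rewrite big_ord_recl -(IHn (fun i => A (lift ord0 i)))//.
rewrite -product_measure1E//; last first.
  rewrite (_ : [set _ | _] = \bigcap_(i in [set: 'I_n])
    (fun x : 'rV[R]_n => x 0 i) @^-1` A (lift ord0 i)); last first.
    by rewrite predeqE => x; split=> [Ax i _|Ax i]; exact: Ax.
  apply: fin_bigcap_measurable => // i _.
  by rewrite -[X in measurable X]setTI; apply: measurable_coord => //; exact: mA.
congr product_measure1; rewrite predeqE => -[x y]; split=> /= [Ax|[Ax Ay] i].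
  split=> [|i]; first by have := Ax ord0; rewrite /insert mxE unlift_none.
  by have := Ax (lift ord0 i); rewrite /insert mxE liftK.
by rewrite /insert mxE; case: unliftP => [q|] ->.
Qed.

Definition unit_cube {R : realType} (n : nat) : set 'rV[R]_n :=
  [set t | forall i, t 0 i \in `[0, 1]].
Arguments unit_cube {R} n _.

Definition qm_norm (R : realType) (d : measure_display) (T : measurableType d)
    (P : probability T R) (xi : T -> R) : R :=
  Num.sqrt (fine 'E_P[fun w => xi w ^+ 2]).

Definition euclidean_norm (R : realType) (n : nat) (u : 'rV[R]_n) : R :=
  Num.sqrt (\sum_i u 0 i ^+ 2).

(* [D] is the parameter set; the values of the field outside [D] are
   irrelevant *)
Definition qm_continuous (R : realType) (d : measure_display)
    (T : measurableType d) (P : probability T R) (n : nat)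
    (D : set 'rV[R]_n) (X : 'rV[R]_n -> T -> R) : Prop :=
  (forall t, D t -> X t \in Lfun P 2%:E) /\
  (forall t, D t ->
     qm_norm P (fun w => X s w - X t w) @[s --> within D (nbhs t)] --> 0).

(* [R^d] is ['rV[R]_(total_dim l)], and the [j]-th component of [s] is
   [submxrow s j], with coordinates [tagnat.Rank j m] of [s] *)
Notation total_dim l := (\sum_i l i)%N.

Definition locally_stationary (R : realType) (d : measure_display)
    (T : measurableType d) (P : probability T R) (k : nat) (l : 'I_k -> nat)
    (alpha : 'I_k -> R) (c : 'I_k -> 'rV[R]_(total_dim l) -> R)
    (X : 'rV[R]_(total_dim l) -> T -> R) : Prop :=
  [/\ qm_continuous P (unit_cube (total_dim l)) X,
      forall j, {within unit_cube (total_dim l), continuous (c j)} /\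
        (forall t, unit_cube (total_dim l) t -> 0 < c j t),
      forall eps : R, 0 < eps ->
        \forall s \near (0 : 'rV[R]_(total_dim l))^',
          forall t, unit_cube (total_dim l) t -> unit_cube (total_dim l) (t + s) ->
          `| qm_norm P (fun w => X (t + s) w - X t w) ^+ 2 /
             (\sum_j c j t * euclidean_norm (submxrow s j) `^ alpha j) - 1 |
          < eps &
      forall j (p : 'S_(total_dim l)),
        perm_on [set i | tagnat.sig1 i == j]%SET p ->
        forall t, unit_cube (total_dim l) t -> c j (col_perm p t) = c j t].

(* Gaussian law; the Dirac masses are the degenerate case, which
   [normal_prob] does not cover *)
Definition gaussian (R : realType) (d : measure_display)
    (T : measurableType d) (P : probability T R) (xi : T -> R) : Prop :=
  measurable_fun [set: T] xi /\
  ((exists m : R, {ae P, forall w, xi w = m}) \/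
   (exists m s : R, 0 < s /\
      forall A : set (measurableTypeR R), measurable A ->
        P (xi @^-1` A) = normal_prob m s A)).

Definition gaussian_field (R : realType) (d : measure_display)
    (T : measurableType d) (P : probability T R) (n : nat)
    (D : set 'rV[R]_n) (B : 'rV[R]_n -> T -> R) : Prop :=
  forall (q : nat) (a : 'I_q -> R) (t : 'I_q -> 'rV[R]_n),
    (forall i, D (t i)) ->
    gaussian P (fun w => \sum_i a i * B (t i) w).

Definition nonneg_orthant {R : realType} (n : nat) : set 'rV[R]_n :=
  [set t | forall i, 0 <= t 0 i].
Arguments nonneg_orthant {R} n _.

Definition fractional_brownian_field (R : realType) (d : measure_display)
    (T : measurableType d) (P : probability T R) (beta : R) (n : nat)
    (B : 'rV[R]_n -> T -> R) : Prop :=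
  [/\ gaussian_field P (nonneg_orthant n) B,
      forall t, nonneg_orthant n t -> ('E_P[B t] = 0)%E &
      forall t s, nonneg_orthant n t -> nonneg_orthant n s ->
        covariance P (B t) (B s) =
        (2^-1 * (euclidean_norm t `^ beta + euclidean_norm s `^ beta
                 - euclidean_norm (t - s) `^ beta))%:E].

(* expectation of [F eta] over a vector [eta] of independent Bernoulli
   variables with means [s 0 0, s 0 1, ...] *)
Definition bernoulli_mean (R : realType) (n : nat) (s : 'rV[R]_n)
    (F : 'rV[R]_n -> R) : R :=
  \sum_(e : {ffun 'I_n -> bool})
    F (\row_i (e i)%:R) *
    \prod_i (s 0 i ^+ e i * (1 - s 0 i) ^+ (~~ e i)).

(* the constant [b_{beta,n}(u)], where [B] is the fractional Brownian field
   with parameter [beta] *)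
Definition fbf_error (R : realType) (d : measure_display)
    (T : measurableType d) (P : probability T R) (n : nat)
    (B : 'rV[R]_n -> T -> R) (u : 'rV[R]_n) : R :=
  \int[lebesgue_row n]_(s in unit_cube n)
    (qm_norm P (fun w =>
       B (map2_mx *%R u s) w
       - bernoulli_mean s (fun e => B (map2_mx *%R u e) w)) ^+ 2).

Definition pos_cont_density (R : realType) (g : R -> R) : Prop :=
  [/\ {within `[0, 1], continuous g},
      forall x, x \in `[0, 1] -> 0 < g x &
      \int[lebesgue_measure]_(x in `[0, 1]) g x = 1].

(* [tau m i], for [i <= n_m^*], is the knot [t_{m,i}] of the [m]-th
   coordinate *)
Definition grid_point (R : realType) (n : nat) (tau : 'I_n -> nat -> R)
    (i : 'I_n -> nat) : 'rV[R]_n :=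
  \row_m tau m (i m).

Definition cross_regular (R : realType) (k : nat) (l : 'I_k -> nat)
    (h : 'I_k -> R -> R) (n : 'I_k -> nat)
    (tau : 'I_(total_dim l) -> nat -> R) (T : set 'rV[R]_(total_dim l)) : Prop :=
  (forall (m : 'I_(total_dim l)) (i : nat), (i <= n (tagnat.sig1 m))%N ->
     tau m i \in `[0, 1] /\
     \int[lebesgue_measure]_(v in `[0, tau m i]) h (tagnat.sig1 m) v
       = i%:R / (n (tagnat.sig1 m))%:R) /\
  T = [set t | exists i : 'I_(total_dim l) -> nat,
         (forall m, (i m <= n (tagnat.sig1 m))%N) /\ t = grid_point tau i].

Definition MPLI (R : realType) (Omega : Type) (k : nat) (l : 'I_k -> nat)
    (n : 'I_k -> nat) (tau : 'I_(total_dim l) -> nat -> R)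
    (X XN : 'rV[R]_(total_dim l) -> Omega -> R) : Prop :=
  forall (i : 'I_(total_dim l) -> nat), (forall m, (i m < n (tagnat.sig1 m))%N) ->
  forall s, unit_cube (total_dim l) s ->
  let t := grid_point tau i in
  let r := grid_point tau (fun m => (i m).+1) - t in
  forall w, XN (t + map2_mx *%R r s) w =
    bernoulli_mean s (fun e => X (t + map2_mx *%R r e) w).

(* the coefficient [v_j] as a function of the density [g = h_j]; [B] is the
   fractional Brownian field with parameter [alpha_j] on the [j]-th
   component *)
Definition error_coef (R : realType) (d : measure_display)
    (T : measurableType d) (P : probability T R) (k : nat) (l : 'I_k -> nat)
    (c : 'I_k -> 'rV[R]_(total_dim l) -> R) (j : 'I_k)
    (B : 'rV[R]_(l j) -> T -> R) (g : R -> R) : R :=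
  \int[lebesgue_row (total_dim l)]_(t in unit_cube (total_dim l))
    (c j t * fbf_error P B (map_mx (fun x => (g x)^-1) (submxrow t j))).

Definition last_ord (n : nat) (n_gt0 : (0 < n)%N) : 'I_n :=
  Ordinal (etrans (congr1 (leq^~ n) (prednK n_gt0)) (leqnn n)).

(* the coordinate that is kept is the last one of the [j]-th component *)
Definition integrated_ls (R : realType) (k : nat) (l : 'I_k -> nat)
    (l_gt0 : forall j, (0 < l j)%N) (c : 'I_k -> 'rV[R]_(total_dim l) -> R)
    (j : 'I_k) (x : R) : R :=
  \int[lebesgue_row (total_dim l).-1]_(y in unit_cube (total_dim l).-1)
    c j (insert (tagnat.Rank j (last_ord (l_gt0 j))) x y).

Definition a_const (R : realType) (beta : R) : R :=
  2 / ((beta + 1) * (beta + 2)) - 6^-1.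

Definition gamma_norm (R : realType) (gamma : R) (f : R -> R) : R :=
  (\int[lebesgue_measure]_(x in `[0, 1]) (f x `^ gamma)) `^ gamma^-1.

Definition opt_density (R : realType) (gamma : R) (f : R -> R) (x : R) : R :=
  f x `^ gamma / \int[lebesgue_measure]_(y in `[0, 1]) (f y `^ gamma).

(* Main.v *)
Require Import Defs.
From HB Require Import structures.
From mathcomp Require Import all_boot all_order all_algebra all_fingroup.
From mathcomp Require Import all_classical all_reals all_analysis.
From mathcomp Require Import measurable_realfun ring lra.

Set Implicit Arguments.
Unset Strict Implicit.
Unset Printing Implicit Defensive.

Import Order.TTheory GRing.Theory Num.Theory.
Import numFieldNormedType.Exports.

Local Open Scope classical_set_scope.
Local Open Scope ring_scope.

(** When [l j = 1], the Brownian field entering [v_j] is a fractional Brownian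
    motion on the half-line, and the error of interpolating it linearly on
    [[0, u]] has a closed form. Expanding the square and using only the
    (zero) mean and the covariance, the mean square error at [u * s] is
    [u `^ alpha * interpolation_error alpha s] ([fbf_error_pointwise]), and the
    integral of [interpolation_error alpha] over [[0, 1]] is
    [a_const alpha] ([Rintegral_interpolation_error]); hence the constant is
    [a_const alpha * u `^ alpha]. With [u = 1 / g (t_p)], where [p] is the
    only coordinate of the [j]-th component, the integrand of [v_j] is [c_j]
    times a function of the single coordinate [t_p], and Tonelli's theorem,
    isolating that coordinate ([Rintegral_unit_cube_slice]), gives the formula
    [v_j = a_const alpha * J g] with [J g] the integral of
    [C x * g x `^ (- alpha)].

    For the minimization put [D] for the integral of [C `^ gamma] and
    [h = C `^ gamma / D], so that [C = D `^ (1 + alpha) * h `^ (1 + alpha)]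
    on [[0, 1]]. Since [r `^ (- alpha)] lies above its tangent at [r = 1],
    [h `^ (1 + alpha) * g `^ (- alpha) >= (1 + alpha) * h - alpha * g]
    pointwise, with equality only where [g = h] ([tangent_powR]). The right
    hand side integrates to [1] because [g] and [h] are densities, so
    [J g >= D `^ (1 + alpha) = J h]. If equality holds, then a nonnegative
    continuous function has integral [0], hence vanishes, and [g = h].

    What is left is regularity: [C] is continuous by dominated convergence
    and bounded below by the minimum of [c_j] over the compact cube, so [h] is
    an admissible density. For this [c_j] is extended continuously to the
    whole space by composition with the retraction onto the cube. *)

(** * Lebesgue measure on rows *)

Lemma measurable_row_box (R : realType) (n : nat)
    (A : 'I_n -> set (measurableTypeR R)) :
  (forall i, measurable (A i)) ->
  measurable [set x : 'rV[R]_n | forall i, A i (x 0 i)].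
Proof.
move=> mA; rewrite (_ : [set _ | _] = \bigcap_(i in [set: 'I_n])
  (fun x : 'rV[R]_n => x 0 i) @^-1` A i); last first.
  by rewrite predeqE => x; split=> [Ax i _|Ax i]; exact: Ax.
apply: fin_bigcap_measurable => // i _.
by rewrite -[X in measurable X]setTI; apply: measurable_coord => //; exact: mA.
Qed.

Lemma row_continuous (R : realType) (T : topologicalType) (n : nat)
    (f : T -> 'rV[R]_n) :
  (forall i, continuous (fun x => f x 0 i)) -> continuous f.
Proof.
move=> cf x A /nbhs_ballP[e /= e0 eA].
have : \forall y \near x, forall i, `|f x 0 i - f y 0 i| < e.
  apply: filter_forall => i.
  by have /cvgrPdist_lt/(_ _ e0) := cf i x.
apply: filterS => y fy; apply: eA; split=> // i j.
by rewrite (ord1 i); exact: fy.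
Qed.

(** The topology of rows is that of the sup norm while the sigma-algebra is the
    one generated by the coordinates, so Borel measurability is not by
    definition. A continuous function is the pointwise limit of its values at
    the points rounded down to multiples of [1 / N.+1]; rounding takes
    countably many values, each on a box. *)
Section continuous_measurable.
Context {R : realType} {n : nat}.

Let round (N : nat) (x : 'rV[R]_n) : 'rV[R]_n :=
  \row_i ((Num.floor (N.+1%:R * x 0 i))%:~R / N.+1%:R).

Let round_cvg (x : 'rV[R]_n) : round N x @[N --> \oo] --> x.
Proof.
move=> A /nbhs_ballP[e /= e0 eA].
have := near_infty_natSinv_lt (PosNum e0); apply: filterS => N /= Ne.
apply: eA; split=> // i j; rewrite (ord1 i) /ball /= mxE.
have N0 : 0 < N.+1%:R :> R by rewrite ltr0n.
have -> : x 0 j - (Num.floor (N.+1%:R * x 0 j))%:~R / N.+1%:R =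
    (N.+1%:R * x 0 j - (Num.floor (N.+1%:R * x 0 j))%:~R) / N.+1%:R.
  by field; rewrite gt_eqF.
have /andP[lex ltx] := floor_itv (N.+1%:R * x 0 j).
rewrite ger0_norm; last by rewrite divr_ge0 ?subr_ge0// ltW.
apply: le_lt_trans Ne; rewrite ler_pdivrMr// mulVf ?gt_eqF//.
by rewrite lerBlDr addrC; move: ltx; rewrite intrD; exact: ltW.
Qed.

Let measurable_round (f : 'rV[R]_n -> R) N :
  measurable_fun setT (f \o round N).
Proof.
move=> _ Y mY; rewrite setTI.
pose z_ (z : 'rV[int]_n) : 'rV[R]_n := \row_i ((z 0 i)%:~R / N.+1%:R).
pose box (z : 'rV[int]_n) : set 'rV[R]_n :=
  [set x | forall i, ((fun y : R => N.+1%:R * y) @^-1`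
                      `[(z 0 i)%:~R, (z 0 i + 1)%:~R[) (x 0 i)].
rewrite (_ : _ @^-1` _ =
  \bigcup_z (if f (z_ z) \in Y then box z else set0)); last first.
  apply/seteqP; split => x /=.
    move=> fY; exists (\row_i Num.floor (N.+1%:R * x 0 i)) => //.
    rewrite ifT; first by move=> i; rewrite /= mxE in_itv/=; exact: floor_itv.
    rewrite inE; congr (Y (f _)) : fY.
    by apply/rowP => i; rewrite !mxE.
  move=> [z _]; case: ifPn => //; rewrite inE => fY zx.
  congr (Y (f _)) : fY; apply/rowP => i; rewrite !mxE.
  by have := zx i; rewrite /= in_itv/= => /floor_def ->.
apply: countable_bigcupT_measurable => // z; case: ifPn => // _.
apply: (@measurable_row_box R n (fun i => (fun y : R => N.+1%:R * y) @^-1`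
  `[(z 0 i)%:~R, (z 0 i + 1)%:~R[)) => i.
rewrite -[X in measurable X]setTI.
have : measurable_fun setT (fun y : R => N.+1%:R * y).
  by apply: measurable_funM => //; exact: measurable_cst.
by apply => //; exact: measurable_itv.
Qed.

Lemma continuous_measurable_row (f : 'rV[R]_n -> R) :
  continuous f -> measurable_fun setT f.
Proof.
move=> cf; apply: (@measurable_fun_cvg _ _ _ setT (fun N => f \o round N)).
  by move=> N; exact: measurable_round.
by move=> x _; apply: continuous_cvg; [exact: cf|exact: round_cvg].
Qed.
End continuous_measurable.

Lemma unit_cubeE (R : realType) (n : nat) : @unit_cube R n =
  [set x : 'rV[R]_n | forall i, `[0, 1]%classic (x 0 i)].
Proof. by []. Qed.

Lemma measurable_unit_cube (R : realType) (n : nat) :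
  measurable (@unit_cube R n).
Proof.
apply: (@measurable_row_box R n (fun=> `[0, 1]%classic)) => i.
exact: measurable_itv.
Qed.

Lemma lebesgue_unit_interval (R : realType) :
  lebesgue_measure (`[0, 1]%classic : set (measurableTypeR R)) = 1%E.
Proof. by rewrite lebesgue_measure_itv /= lte_fin ltr01 oppr0 adde0. Qed.

Lemma lebesgue_unit_cube (R : realType) (n : nat) :
  lebesgue_row n (@unit_cube R n) = 1%E.
Proof.
rewrite unit_cubeE (@lebesgue_row_box _ _ (fun=> `[0, 1]%classic)); last first.
  by move=> i; exact: measurable_itv.
by rewrite big1// => i _; exact: lebesgue_unit_interval.
Qed.

Lemma unit_cube_insert (R : realType) (m : nat) (p : 'I_m.+1) (x : R)
    (y : 'rV[R]_m) :
  unit_cube m.+1 (insert p x y) <-> x \in `[0, 1] /\ unit_cube m y.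
Proof.
split=> [xy|[x01 y01] i].
  split=> [|i]; first by have := xy p; rewrite mxE unlift_none.
  by have := xy (lift p i); rewrite mxE liftK.
by rewrite mxE; case: unliftP.
Qed.

Section insert_measure.
Context {R : realType} (m : nat) (p : 'I_m.+1).

Let ins (z : R * 'rV[R]_m) : 'rV[R]_m.+1 := insert p z.1 z.2.
Let mins : measurable_fun setT ins := @measurable_insert R m.+1 p.

HB.instance Definition _ := isMeasurableFun.Build _ _ _ _ ins mins.

Let boxes : set (set 'rV[R]_m.+1) :=
  [set B | exists A : 'I_m.+1 -> set (measurableTypeR R),
    (forall i, measurable (A i)) /\
    B = [set x : 'rV[R]_m.+1 | forall i, A i (x 0 i)]].

(** [lebesgue_row] is built by inserting coordinates in front. Inserting one at
    any other position [p] gives the same measure, because both agree on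
    boxes, which are stable under intersection and generate the
    sigma-algebra. *)
Lemma lebesgue_row_insert (A : set 'rV[R]_m.+1) : measurable A ->
  lebesgue_row m.+1 A =
  pushforward (@lebesgue_measure R \x lebesgue_row m)%E
    (fun z : R * 'rV[R]_m => insert p z.1 z.2 : 'rV[R]_m.+1) A.
Proof.
(* an exhausting sequence of boxes of finite measure *)
pose K (k : nat) : set 'rV[R]_m.+1 :=
  [set x : 'rV[R]_m.+1 | forall i, `[- k%:R, k%:R]%classic (x 0 i)].
have mK (k : nat) : boxes (K k).
  by exists (fun=> `[- k%:R, k%:R]%classic).
apply: (measure_unique boxes K) => //.
- apply/seteqP; split.
    apply: sub_sigma_algebra2.
    rewrite -bigcup_seq => _ [i _ [B mB <-]].
    exists (fun j => if j == i then B else setT); split.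
      by move=> j; case: ifP.
    apply/seteqP; split => x /=.
      by move=> [_ Bx] j; case: eqP => // ->.
    by move=> /(_ i); rewrite eqxx.
  apply: smallest_sub; first exact: sigma_algebra_measurable.
  by move=> _ [B [mB ->]]; exact: measurable_row_box.
- move=> _ _ [A1 [mA1 ->]] [A2 [mA2 ->]].
  exists (fun i => A1 i `&` A2 i); split=> [i|]; first exact: measurableI.
  apply/seteqP; split=> x /= => [[x1 x2] i|x12]; first by split.
  by split=> i; case: (x12 i).
- rewrite -subTset => x _.
  have /cvgryPge cK := @cvgr_idn R.
  have : \forall k \near \oo, forall i, `|x 0 i| <= k%:R.
    by apply: filter_forall => i; exact: (cK `|x 0 i|).
  move=> [k _ kx]; exists k => // i; rewrite /= in_itv/= -ler_norml.
  by apply: kx => /=.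
- move=> _ [B [mB ->]].
  have mB' : measurable [set y : 'rV[R]_m | forall i, B (lift p i) (y 0 i)].
    by apply: (@measurable_row_box R m (fun i => B (lift p i))) => i.
  rewrite [LHS](lebesgue_row_box mB) (bigD1_ord p)//=.
  rewrite -(lebesgue_row_box (A := fun i => B (lift p i)))//.
  rewrite -product_measure1E//; congr product_measure1.
  apply/seteqP; split=> -[x y]/=.
    by move=> [Bx By] i; rewrite mxE; case: unliftP => [q|] ->.
  move=> Bxy; split=> [|i]; first by have := Bxy p; rewrite mxE unlift_none.
  by have := Bxy (lift p i); rewrite mxE liftK.
- move=> k.
  rewrite [ltLHS](_ : _ =
      (\prod_(i < m.+1) @lebesgue_measure R `[(- k%:R)%R, k%:R%R]%classic)%E);
    last first.
    by apply: (@lebesgue_row_box _ _ (fun=> `[- k%:R, k%:R]%classic)) => i.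
  rewrite (eq_bigr (fun=> (fine (lebesgue_measure
      (`[- k%:R, k%:R]%classic : set (measurableTypeR R))))%:E)) ?prodEFin ?ltry//.
  move=> i _; rewrite fineK// lebesgue_measure_itv/=.
  by case: ifP.
Qed.

(** Tonelli's theorem through [lebesgue_row_insert], the preimage of the cube
    under [insert p] being the product of [[0, 1]] and a cube. *)
Lemma ge0_integral_unit_cube (f : 'rV[R]_m.+1 -> \bar R) :
  measurable_fun (unit_cube m.+1) f ->
  (forall t, unit_cube m.+1 t -> (0 <= f t)%E) ->
  (\int[lebesgue_row m.+1]_(t in unit_cube m.+1) f t =
   \int[@lebesgue_measure R]_(x in `[0%R, 1%R])
     \int[lebesgue_row m]_(y in unit_cube m) f (insert p x y))%E.
Proof.
move=> mf f0.
have mC := @measurable_unit_cube R m.+1.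
rewrite (eq_measure_integral _ (fun A mA _ => lebesgue_row_insert mA)).
rewrite ge0_integral_pushforward//; last by move=> t /set_mem; exact: f0.
rewrite integral_mkcond fubini_tonelli1; last 2 first.
- have mD : measurable (ins @^-1` unit_cube m.+1).
    by rewrite -[X in measurable X]setTI; exact: mins.
  apply: (proj1 (measurable_restrictT _ mD)).
  apply: (measurable_comp mC _ mf); first by move=> _ [z zD <-].
  exact: measurable_funTS mins.
- by move=> z; rewrite patchE; case: ifPn => // /set_mem; exact: f0.
rewrite [RHS]integral_mkcond; apply: eq_integral => x _.
rewrite /fubini_F [RHS]patchE; case: ifPn => [/set_mem x01|/negP x01].
  rewrite [RHS]integral_mkcond; apply: eq_integral => y _.
  rewrite !patchE; congr (if _ then _ else _); apply/idP/idP => /set_mem.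
    by move=> /unit_cube_insert[_ y01]; exact/mem_set.
  by move=> y01; apply/mem_set/unit_cube_insert.
rewrite integral0_eq// => y _; rewrite patchE ifN//.
by apply: contra_notN x01 => /set_mem/unit_cube_insert[x01 _]; exact/mem_set.
Qed.
End insert_measure.

(** * Continuous functions on the unit interval *)

(** Continuity within a set is all that densities and powers offer at the end
    points, so composition has to be available relative to subsets. *)
Lemma within_continuous_comp (S T U : topologicalType) (A : set S) (B : set T)
    (g : S -> T) (f : T -> U) :
  continuous g -> (forall x, A x -> B (g x)) -> {within B, continuous f} ->
  {within A, continuous (f \o g)}.
Proof.
move=> cg AB /subspace_continuousP cf; apply/subspace_continuousP => x Ax.
apply: (cvg_comp g f _ (cf _ (AB _ Ax))) => V.
rewrite /within/= => /cg; rewrite /fmap/= => nV.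
suff : nbhs x [set y | A y -> V (g y)] by [].
have : nbhs x [set y | B (g y) -> V (g y)] by exact: nV.
by apply: filterS => y BV /AB.
Qed.

Lemma powR_continuous_at (R : realType) (b x : R) : 0 < x ->
  {for x, continuous (fun y : R => y `^ b)}.
Proof.
move=> x0; apply/differentiable_continuous; rewrite -derivable1_diffP.
by have [] := is_derive1_powR b x0.
Qed.

Section unit_interval.
Context {R : realType}.
Implicit Types f g : R -> R.

Let mu := @lebesgue_measure R.

Lemma within01_powR f b : {within `[0, 1], continuous f} ->
  (forall x, x \in `[0, 1] -> 0 < f x) ->
  {within `[0, 1], continuous (fun x => f x `^ b)}.
Proof.
move=> cf f0; rewrite continuous_subspace_in => x /set_mem x01.
have cp : {for f x, continuous (fun y : R => y `^ b)}.
  exact: powR_continuous_at (f0 _ x01).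
by apply: (continuous_cvg _ cp); exact: cf.
Qed.

Lemma within01_mul f g : {within `[0, 1], continuous f} ->
  {within `[0, 1], continuous g} -> {within `[0, 1], continuous (f \* g)}.
Proof. by move=> cf cg x; apply: cvgM; [exact: cf|exact: cg]. Qed.

Lemma within01_integrable f : {within `[0, 1], continuous f} ->
  mu.-integrable `[0, 1] (EFin \o f).
Proof.
by move=> cf; apply: continuous_compact_integrable => //; exact: segment_compact.
Qed.

Lemma Rintegral01_cst (r : R) : \int[mu]_(x in `[0, 1]) r = r.
Proof. by rewrite Rintegral_cst//= lebesgue_unit_interval mulr1. Qed.

Lemma Rintegral01_gt0 f : {within `[0, 1], continuous f} ->
  (forall x, x \in `[0, 1] -> 0 < f x) -> 0 < \int[mu]_(x in `[0, 1]) f x.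
Proof.
move=> cf f0; have [x x01 fx] := EVT_min ler01 cf.
apply: (lt_le_trans (f0 _ x01)); rewrite -[leLHS]Rintegral01_cst.
apply: le_Rintegral => //; last exact: within01_integrable.
by apply: within01_integrable => y; exact: cst_continuous.
Qed.

(** If [f x > 0], then [f >= f x / 2] on the trace on [[0, 1]] of a
    neighbourhood of [x]; this trace contains a nondegenerate interval, even
    when [x] is an end point. *)
Lemma Rintegral01_eq0 f : {within `[0, 1], continuous f} ->
  (forall x, x \in `[0, 1] -> 0 <= f x) -> \int[mu]_(x in `[0, 1]) f x = 0 ->
  forall x, x \in `[0, 1] -> f x = 0.
Proof.
move=> cf f0 intf x x01; apply/eqP; rewrite eq_le f0// andbT leNgt.
apply/negP => fx0.
have fx2 : 0 < f x / 2 by rewrite divr_gt0.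
have /subspace_continuousP/(_ x x01)/cvgrPdist_lt/(_ _ fx2) := cf.
rewrite near_withinE => /nbhs_ballP[e /= e0 xe].
have /andP[x0 x1] : 0 <= x <= 1 by move: x01; rewrite in_itv.
pose lo := Num.max 0 (x - e / 2); pose hi := Num.min 1 (x + e / 2).
have e2 : 0 < e / 2 by rewrite divr_gt0.
have lohi : lo < hi by rewrite /lo /hi gt_max !lt_min; apply/and3P; split; lra.
have J01 : `[lo, hi] `<=` `[0, 1].
  move=> y; rewrite /= !in_itv/= /lo /hi ge_max le_min.
  by move=> /andP[/andP[-> _] /andP[-> _]].
have fJ y : y \in `[lo, hi] -> f x / 2 <= f y.
  move=> yJ; have y01 := J01 _ yJ.
  have : `|f x - f y| < f x / 2.
    apply: xe => //; rewrite /ball/= ltr_norml.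
    move: yJ; rewrite in_itv/= /lo /hi ge_max le_min => /andP[/andP[_ ?] /andP[_ ?]].
    by apply/andP; split; lra.
  by rewrite ltr_norml => /andP[_ ?]; lra.
have : ((f x / 2)%:E * mu `[lo, hi] <= \int[mu]_(x in `[0%R, 1%R]) (f x)%:E)%E.
  rewrite -integral_cst//.
  have mf := measurable_int _ (within01_integrable cf).
  apply: (@le_trans _ _ (\int[mu]_(x in `[lo, hi]) (f x)%:E)%E).
    apply: ge0_le_integral => //.
      by move=> y _; rewrite lee_fin ltW.
    exact: measurable_funS mf.
  by apply: (ge0_subset_integral mu) => // y y01; rewrite lee_fin f0.
have -> : (\int[mu]_(x in `[0%R, 1%R]) (f x)%:E = 0)%E.
  rewrite -[LHS]fineK; first by congr EFin.
  by apply: integrable_fin_num => //; exact: within01_integrable.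
rewrite /mu lebesgue_measure_itv/= lte_fin lohi -EFinB -EFinM lee_fin leNgt.
by rewrite mulr_gt0// subr_gt0.
Qed.

End unit_interval.

(** * The optimal density *)

Lemma powRE (R : realType) (x b : R) : 0 < x -> x `^ b = expR (b * ln x).
Proof. by move=> x0; rewrite /powR gt_eqF. Qed.

(** After division by [h], this is [r `^ (- a) >= 1 - a * (r - 1)] with
    [r = g / h], which follows from [expR y >= 1 + y] at [y = - a * ln r] and
    [ln r <= r - 1]. *)
Lemma tangent_powR (R : realType) (a h g : R) : 0 < a -> 0 < h -> 0 < g ->
  (1 + a) * h - a * g <= h `^ (1 + a) * g `^ (- a) ?= iff (g == h).
Proof.
move=> a0 h0 g0.
have r0 : 0 < g / h by rewrite divr_gt0.
pose u := ln (g / h).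
have -> : h `^ (1 + a) * g `^ (- a) = h * expR (- (a * u)).
  rewrite !powRE// -expRD -[X in X * expR _](@lnK R)//.
  by rewrite -expRD /u lnM ?posrE ?invr_gt0// lnV ?posrE//; congr expR; ring.
have ur : u <= g / h - 1.
  have := @le_ln1Dx R (g / h - 1); rewrite (addrC 1) subrK; apply.
  by rewrite ltrBDr addNr.
have hu : h * u <= g - h.
  have -> : g - h = h * (g / h - 1) by field; rewrite gt_eqF.
  by rewrite ler_pM2l.
have tan : (1 + a) * h - a * g <= h * (1 - a * u).
  have : a * (h * u) <= a * (g - h) by rewrite ler_pM2l.
  by lra.
split; first by apply: (le_trans tan); rewrite ler_pM2l// expR_ge1Dx.
have [gh|gh] := eqVneq g h.
  by apply/eqP; rewrite /u gh divff ?gt_eqF// ln1 mulr0 oppr0 expR0; ring.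
apply/negbTE; rewrite lt_eqF//; apply: (le_lt_trans tan).
rewrite ltr_pM2l// expR_gt1Dx// oppr_eq0 mulf_eq0 gt_eqF//= /u ln_eq0//.
by apply: contra gh => /eqP/divr1_eq ->.
Qed.

(** The minimization of the integral of [C x * g x `^ (- a)] over densities
    [g]: up to the factor [D `^ (1 + a)] and the constant [1], this integral is
    that of the nonnegative function [defect g]. *)
Section optimal_density.
Context {R : realType}.
Variables (a : R) (C : R -> R).
Hypotheses (a0 : 0 < a) (cC : {within `[0, 1], continuous C}).
Hypothesis C0 : forall x, x \in `[0, 1] -> 0 < C x.

Let mu := @lebesgue_measure R.
Let gamma := 1 / (1 + a).
Let h := opt_density gamma C.
Let D := \int[mu]_(x in `[0, 1]) (C x `^ gamma).

Let D0 : 0 < D.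
Proof.
apply: Rintegral01_gt0 => [|x x01]; first exact: within01_powR.
by rewrite powR_gt0// C0.
Qed.

Lemma opt_density_pos_cont : pos_cont_density h.
Proof.
split.
- apply: within01_mul; first exact: within01_powR.
  by move=> x; exact: cst_continuous.
- by move=> x x01; rewrite divr_gt0// powR_gt0// C0.
- rewrite /h/opt_density RintegralZr//; first exact/divff/lt0r_neq0.
  exact/within01_integrable/within01_powR.
Qed.

(* as [gamma * (1 + a) = 1] *)
Let CE x : x \in `[0, 1] -> C x = D `^ (1 + a) * h x `^ (1 + a).
Proof.
move=> x01; have Cx := C0 x01.
rewrite -powRM ?divr_ge0 ?powR_ge0 ?ltW//.
rewrite [D * _]mulrC divfK ?gt_eqF// -powRrM /gamma div1r mulVf ?powRr1 ?ltW//.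
by rewrite gt_eqF// addr_gt0.
Qed.

Let J (g : R -> R) := \int[mu]_(x in `[0, 1]) (C x * g x `^ (- a)).

(* the gap in [tangent_powR] *)
Let defect g x := h x `^ (1 + a) * g x `^ (- a) - ((1 + a) * h x - a * g x).

Let h0 x : x \in `[0, 1] -> 0 < h x.
Proof. by have [_ + _] := opt_density_pos_cont; exact. Qed.

Let ch : {within `[0, 1], continuous h}.
Proof. by have [] := opt_density_pos_cont. Qed.

Let cont_defect g : pos_cont_density g -> {within `[0, 1], continuous (defect g)}.
Proof.
move=> [cg g0 _].
have c1 := within01_mul (within01_powR (b := 1 + a) ch h0)
  (within01_powR (b := - a) cg g0).
move=> x; apply: cvgB; first exact: c1.
by apply: cvgB; apply: cvgM; [exact: cvg_cst|exact: ch|exact: cvg_cst|exact: cg].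
Qed.

Let J_defect g : pos_cont_density g ->
  J g = D `^ (1 + a) * (1 + \int[mu]_(x in `[0, 1]) defect g x).
Proof.
move=> dg; have [cg g0 g1] := dg; have [_ _ h1] := opt_density_pos_cont.
have id := within01_integrable (cont_defect dg).
have ih r : mu.-integrable `[0, 1] (EFin \o (fun x => r * h x)).
  apply: within01_integrable => x.
  by apply: cvgM; [exact: cvg_cst|exact: ch].
have ig r : mu.-integrable `[0, 1] (EFin \o (fun x => r * g x)).
  apply: within01_integrable => x.
  by apply: cvgM; [exact: cvg_cst|exact: cg].
have igh : mu.-integrable `[0, 1] (EFin \o (fun x => (1 + a) * h x - a * g x)).
  apply: within01_integrable => x; apply: cvgB.
    by apply: cvgM; [exact: cvg_cst|exact: ch].
  by apply: cvgM; [exact: cvg_cst|exact: cg].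
have e1 : \int[mu]_(x in `[0, 1]) ((1 + a) * h x - a * g x) = 1.
  rewrite RintegralB// !RintegralZl//; last 2 first.
    exact: within01_integrable.
    exact: within01_integrable.
  by rewrite g1 h1; ring.
rewrite -[X in _ * (X + _)]e1 -RintegralD// -RintegralZl//; last first.
  by have := integrableD _ igh id; apply.
apply: eq_Rintegral => x /set_mem x01.
by rewrite CE// /defect; ring.
Qed.

Lemma opt_density_value : J h = D `^ (1 + a).
Proof.
rewrite J_defect; last exact: opt_density_pos_cont.
rewrite -[RHS]mulr1; congr (_ * _); rewrite -[RHS]addr0; congr (_ + _).
rewrite -[RHS](Rintegral01_cst 0); apply: eq_Rintegral => x /set_mem x01.
have hx := h0 x01.
have [_] := tangent_powR a0 hx hx; rewrite eqxx => /eqP.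
by rewrite /defect => ->; rewrite subrr.
Qed.

Lemma opt_density_min g : pos_cont_density g -> J h <= J g.
Proof.
move=> dg; rewrite opt_density_value J_defect// ler_peMr ?powR_ge0//.
rewrite lerDl; apply: Rintegral_ge0 => x x01; rewrite subr_ge0.
have [_ g0 _] := dg.
exact: (tangent_powR a0 (h0 x01) (g0 x x01)).1.
Qed.

Lemma opt_density_unique g : pos_cont_density g -> J g = J h ->
  forall x, x \in `[0, 1] -> g x = h x.
Proof.
move=> dg; rewrite opt_density_value J_defect// -[RHS]mulr1.
move=> /(mulfI (lt0r_neq0 (powR_gt0 _ D0))) /eqP.
rewrite -[eqbRHS]addr0 (inj_eq (addrI _)) => /eqP defect0 x x01.
have [_ g0 _] := dg; have [tle teq] := tangent_powR a0 (h0 x01) (g0 x x01).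
apply/eqP; rewrite -teq eq_sym -subr_eq0; apply/eqP.
apply: (Rintegral01_eq0 (cont_defect dg)) => // y y01.
by rewrite subr_ge0; exact: (tangent_powR a0 (h0 y01) (g0 y y01)).1.
Qed.

End optimal_density.

(** * The interpolation error of fractional Brownian motion *)

Section moments01.
Context {R : realType}.
Let mu := @lebesgue_measure R.

(** At [0] the function [y `^ b] is not differentiable for [b < 1], and its
    value there for [b > 0] does not come from the formula [expR (b * ln y)]:
    the end point is treated by hand, [y `^ b < e] holding when
    [y < e `^ b^-1]. *)
Lemma within01_powR_id (b : R) : 0 < b ->
  {within `[0, 1], continuous (fun x : R => x `^ b)}.
Proof.
move=> b0; apply/subspace_continuousP => x; rewrite /= in_itv/= => /andP[x0 _].
have [xgt0|xle0] := ltP 0 x; last first.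
  have -> : x = 0 by apply/eqP; rewrite eq_le xle0.
  rewrite /from_subspace powR0 ?gt_eqF//; apply/cvgrPdist_lt => e e0.
  rewrite near_withinE; apply/nbhs_ballP; exists (e `^ b^-1) => /=.
    by rewrite powR_gt0.
  move=> y; rewrite /ball/= !sub0r !normrN in_itv/= => + /andP[y0 _].
  rewrite !ger0_norm ?powR_ge0// => ye.
  rewrite -[ltRHS](powRr1 (ltW e0)) -(mulVf (lt0r_neq0 b0)) powRrM.
  by rewrite gt0_ltr_powR// nnegrE powR_ge0.
by apply: cvg_within_filter; exact: powR_continuous_at.
Qed.

Lemma Rintegral01_powR (b : R) : 0 < b ->
  \int[mu]_(x in `[0, 1]) (x `^ b) = (b + 1)^-1.
Proof.
move=> b0; have b1 : 0 < b + 1 by rewrite addr_gt0.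
pose F (x : R) : R := (b + 1)^-1 * x `^ (b + 1).
have dF (x : R) : 0 < x -> is_derive x 1 F (x `^ b).
  move=> x0; have dp := is_derive1_powR (b + 1) x0.
  apply: is_derive_eq; rewrite addrK.
  by rewrite -[LHS]/(_ * (_ * _)) mulrA mulVf ?mul1r// gt_eqF.
have cF : {within `[0, 1], continuous F}.
  by move=> x; apply: cvgM; [exact: cvg_cst|exact: within01_powR_id].
have /(continuous_within_itvP _ ltr01)[_ F0 F1] := cF.
rewrite /Rintegral (continuous_FTC2 ltr01 (within01_powR_id b0) (F := F)).
- by rewrite /F powR1 powR0 ?gt_eqF// mulr0 mulr1 sube0.
- split=> // x; rewrite in_itv/= => /andP[x0 _].
  by have [] := dF _ x0.
- move=> x; rewrite in_itv/= => /andP[x0 _]; rewrite derive1E.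
  by have [_ ->] := dF _ x0.
Qed.

Lemma within01_powR_onem (r : R) : 0 < r ->
  {within `[0, 1], continuous (fun x : R => (1 - x) `^ r)}.
Proof.
move=> r0.
apply: (within_continuous_comp (g := fun y : R => 1 - y) _ _
  (within01_powR_id r0)).
  by move=> x; apply: cvgB; [exact: cvg_cst|exact: cvg_id].
by move=> x; rewrite /= !in_itv/= => /andP[? ?]; apply/andP; split; lra.
Qed.

(** The mean square error at [s] of linear interpolation, from its values at
    [0] and [1], of the fractional Brownian motion with exponent [b]. *)
Definition interpolation_error (b s : R) : R :=
  s `^ b + s ^+ 2 - s * (s `^ b + 1 - (1 - s) `^ b).

Lemma within01_interpolation_error (b : R) : 0 < b ->
  {within `[0, 1], continuous (interpolation_error b)}.
Proof.
move=> b0.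
have ci : {within `[0, 1], continuous (fun x : R => x)}.
  by apply: continuous_subspaceT => x; exact: cvg_id.
have cP := within01_powR_id b0; have cQ := within01_powR_onem b0 => x.
apply: cvgB; first by apply: cvgD; [exact: cP|apply: cvgM; exact: ci].
apply: cvgM; first exact: ci.
apply: cvgB; last exact: cQ.
by apply: cvgD; [exact: cP|exact: cvg_cst].
Qed.

Lemma Rintegral_interpolation_error (b : R) : 0 < b ->
  \int[mu]_(s in `[0, 1]) interpolation_error b s = a_const b.
Proof.
move=> b0; have b1 : 0 < b + 1 by rewrite addr_gt0.
have iP r : 0 < r -> mu.-integrable `[0, 1] (EFin \o (fun x : R => x `^ r)).
  by move=> r0; exact/within01_integrable/within01_powR_id.
have iQ r : 0 < r ->
    mu.-integrable `[0, 1] (EFin \o (fun x : R => (1 - x) `^ r)).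
  by move=> r0; exact/within01_integrable/within01_powR_onem.
have IQ r : 0 < r -> \int[mu]_(x in `[0, 1]) ((1 - x) `^ r) = (r + 1)^-1.
  move=> r0; rewrite -(Rintegral01_powR r0).
  rewrite [RHS](Rintegration_by_substitution_onem (G := fun x : R => x `^ r))//.
  - by rewrite /unstable.onem subrr.
  - by apply/andP.
  - exact: within01_powR_id.
(* [s * (1 - s) `^ b = (1 - s) `^ b - (1 - s) `^ (b + 1)]: only integrals of
   powers of [s] and of [1 - s] remain *)
transitivity (\int[mu]_(s in `[0, 1])
    (((s `^ b + s `^ 2) - (s `^ (b + 1) + s `^ 1)) +
     ((1 - s) `^ b - (1 - s) `^ (b + 1)))).
  apply: eq_Rintegral => s /set_mem; rewrite /= in_itv/= => /andP[s0 s1].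
  have pS (x : R) : 0 <= x -> x `^ (b + 1) = x `^ b * x.
    by move=> x0; rewrite powRD ?powRr1//; apply/implyP; rewrite (gt_eqF b1).
  rewrite /interpolation_error powRr1// powR_mulrn//.
  by rewrite !pS ?subr_ge0//; ring.
have iS p q : 0 < p -> 0 < q ->
    mu.-integrable `[0, 1] (EFin \o (fun s : R => s `^ p + s `^ q)).
  by move=> p0 q0; have := integrableD _ (iP p p0) (iP q q0); apply.
have i1 := iS b 2 b0 (ltr0n _ 2).
have i2 := iS _ 1 b1 ltr01.
have i3 : mu.-integrable `[0, 1]
    (EFin \o (fun s : R => (1 - s) `^ b - (1 - s) `^ (b + 1))).
  by have := integrableB _ (iQ _ b0) (iQ _ b1); apply.
have i4 : mu.-integrable `[0, 1] (EFin \o (fun s : R =>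
    (s `^ b + s `^ 2) - (s `^ (b + 1) + s `^ 1))).
  by have := integrableB _ i1 i2; apply.
have iP1 := iP _ b1; have iP1' := iP 1 ltr01; have iP2 := iP 2 (ltr0n _ 2).
have m01 : measurable (`[0, 1]%classic : set (measurableTypeR R)).
  exact: measurable_itv.
have /= -> := RintegralD m01 i4 i3.
have /= -> := RintegralB m01 i1 i2.
have /= -> := RintegralB m01 (iQ _ b0) (iQ _ b1).
have /= -> := RintegralD m01 (iP _ b0) iP2.
have /= -> := RintegralD m01 iP1 iP1'.
rewrite !IQ// !Rintegral01_powR//.
rewrite /a_const; field.
by apply/andP; split; rewrite gt_eqF//; lra.
Qed.
End moments01.

Section second_moments.
Context {R : realType} {d : measure_display} {T : measurableType d}.
Variable P : probability T R.
Implicit Types X Y Z : T -> R.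

Lemma qm_norm_sqrE X : qm_norm P X ^+ 2 = \int[P]_(w in setT) (X w ^+ 2).
Proof.
rewrite /qm_norm sqr_sqrtr; last first.
  by apply/fine_ge0/expectation_ge0 => w; exact: sqr_ge0.
by rewrite unlock.
Qed.

Lemma integrable_mul_sqr X Y :
  measurable_fun setT X -> measurable_fun setT Y ->
  P.-integrable setT (EFin \o (fun w => X w * X w)) ->
  P.-integrable setT (EFin \o (fun w => Y w * Y w)) ->
  P.-integrable setT (EFin \o (fun w => X w * Y w)).
Proof.
move=> mX mY iX iY.
apply: (@le_integrable _ _ _ _ _ _ _
    (EFin \o (fun w => X w * X w + Y w * Y w))) => //.
- by apply/measurable_EFinP; exact: measurable_funM.
- move=> w _ /=; rewrite lee_fin.
  rewrite [leRHS]ger0_norm ?addr_ge0 -?expr2 ?sqr_ge0//.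
  rewrite normrM -(real_normK (num_real (X w))) -(real_normK (num_real (Y w))).
  have := sqr_ge0 (`|X w| - `|Y w|); have := sqr_ge0 (`|X w| + `|Y w|); nra.
- by have := integrableD measurableT iX iY; apply.
Qed.

Let integrable_lin (f g : T -> R) (a : R) :
  P.-integrable setT (EFin \o f) -> P.-integrable setT (EFin \o g) ->
  P.-integrable setT (EFin \o (fun w => f w + a * g w)).
Proof.
move=> i_f i_g; have := integrableZl measurableT a i_g.
by move/(integrableD measurableT i_f); apply.
Qed.

Let Rintegral_lin (f g : T -> R) (a : R) :
  P.-integrable setT (EFin \o f) -> P.-integrable setT (EFin \o g) ->
  \int[P]_(w in setT) (f w + a * g w) =
  \int[P]_(w in setT) f w + a * \int[P]_(w in setT) g w.
Proof.
move=> i_f i_g; rewrite -RintegralZl//.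
have i_ag := integrableZl measurableT a i_g.
by have /= -> := RintegralD measurableT i_f i_ag.
Qed.

Lemma second_moment_lin X Y Z (p q : R) :
  measurable_fun setT X -> measurable_fun setT Y -> measurable_fun setT Z ->
  P.-integrable setT (EFin \o (fun w => X w * X w)) ->
  P.-integrable setT (EFin \o (fun w => Y w * Y w)) ->
  P.-integrable setT (EFin \o (fun w => Z w * Z w)) ->
  let m U V := \int[P]_(w in setT) (U w * V w) in
  \int[P]_(w in setT) (X w - (p * Y w + q * Z w)) ^+ 2 =
  m X X + p ^+ 2 * m Y Y + q ^+ 2 * m Z Z - 2 * p * m X Y - 2 * q * m X Z
  + 2 * p * q * m Y Z.
Proof.
move=> mX mY mZ iX iY iZ m.
have iXY := integrable_mul_sqr mX mY iX iY.
have iXZ := integrable_mul_sqr mX mZ iX iZ.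
have iYZ := integrable_mul_sqr mY mZ iY iZ.
have i1 := integrable_lin (p ^+ 2) iX iY.
have i2 := integrable_lin (q ^+ 2) i1 iZ.
have i3 := integrable_lin (- (2 * p)) i2 iXY.
have i4 := integrable_lin (- (2 * q)) i3 iXZ.
transitivity (\int[P]_(w in setT)
  (X w * X w + p ^+ 2 * (Y w * Y w) + q ^+ 2 * (Z w * Z w)
   + - (2 * p) * (X w * Y w) + - (2 * q) * (X w * Z w)
   + (2 * p * q) * (Y w * Z w))).
  by apply: eq_Rintegral => w _; ring.
rewrite (Rintegral_lin _ i4 iYZ) (Rintegral_lin _ i3 iXZ).
rewrite (Rintegral_lin _ i2 iXY) (Rintegral_lin _ i1 iZ) (Rintegral_lin _ iX iY).
by rewrite /m; ring.
Qed.
End second_moments.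

Section fbf_dim1.
Context {R : realType} {d : measure_display} {T : measurableType d}.
Variables (P : probability T R) (beta : R) (n : nat) (B : 'rV[R]_n -> T -> R).
Hypothesis B_fbf : fractional_brownian_field P beta B.
Hypothesis beta0 : 0 < beta.

Definition fbf_cov (t s : 'rV[R]_n) : R :=
  2^-1 * (euclidean_norm t `^ beta + euclidean_norm s `^ beta
          - euclidean_norm (t - s) `^ beta).

(** The linear combination with the single coefficient [1] is Gaussian, and a
    Gaussian variable is measurable. *)
Lemma fbf_measurable t : nonneg_orthant n t -> measurable_fun setT (B t).
Proof.
move=> t0; have [gB _ _] := B_fbf.
have [mB _] := gB 1%N (fun=> 1) (fun=> t) (fun=> t0).
by apply: eq_measurable_fun mB => w _; rewrite big_ord1 mul1r.
Qed.

Let integral_fbf_mul t s : nonneg_orthant n t -> nonneg_orthant n s ->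
  (\int[P]_w (B t w * B s w)%:E = (fbf_cov t s)%:E)%E.
Proof.
move=> t0 s0; have [_ E0 cB] := B_fbf.
rewrite -cB// [in RHS]unlock !E0//= unlock.
apply: eq_integral => w _; congr EFin.
by rewrite -[RHS]/((B t w - 0) * (B s w - 0)) !subr0.
Qed.

(** Square integrability follows from the finiteness of the prescribed
    covariance at [(t, t)], without computing moments of normal laws. *)
Lemma fbf_integrable t : nonneg_orthant n t ->
  P.-integrable setT (EFin \o (fun w => B t w * B t w)).
Proof.
move=> t0; have mB := fbf_measurable t0.
apply/integrableP; split; first by apply/measurable_EFinP/measurable_funM.
under eq_integral do rewrite /= ger0_norm -?expr2 ?sqr_ge0 ?expr2//.
by rewrite integral_fbf_mul// ltry.
Qed.

Lemma fbf_moment t s : nonneg_orthant n t -> nonneg_orthant n s ->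
  \int[P]_(w in setT) (B t w * B s w) = fbf_cov t s.
Proof. by move=> t0 s0; rewrite /Rintegral integral_fbf_mul. Qed.

End fbf_dim1.

Lemma bernoulli_mean1 (R : realType) (s : 'rV[R]_1) (F : 'rV[R]_1 -> R) :
  bernoulli_mean s F = (1 - s 0 0) * F 0 + s 0 0 * F (const_mx 1).
Proof.
rewrite /bernoulli_mean.
rewrite (reindex (fun b : bool => [ffun=> b] : {ffun 'I_1 -> bool})); last first.
  exists (fun e : {ffun 'I_1 -> bool} => e ord0) => [b _|e _]; rewrite ?ffunE//.
  by apply/ffunP => i; rewrite ffunE (ord1 i).
rewrite big_bool/= !big_ord1 !ffunE/= !expr0 !expr1 mul1r mulr1 addrC.
rewrite mulrC; congr (_ * F _ + _); first by apply/rowP => i; rewrite !mxE ffunE.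
by rewrite mulrC; congr (_ * F _); apply/rowP => i; rewrite !mxE ffunE.
Qed.

Lemma euclidean_norm1 (R : realType) (u : 'rV[R]_1) :
  euclidean_norm u = `|u 0 0|.
Proof. by rewrite /euclidean_norm big_ord1 sqrtr_sqr. Qed.

(** On the segment [[0, u]] the interpolator is
    [(1 - s) * B 0 + s * B u]. The terms with [B 0] drop out, as
    [0 `^ beta = 0] makes its covariance with every [B t] zero, and the scaling
    factor [u `^ beta] comes out of the remaining covariances. *)
Lemma fbf_error_pointwise (R : realType) (d : measure_display)
    (T : measurableType d) (P : probability T R) (beta : R)
    (B : 'rV[R]_1 -> T -> R) (u s : 'rV[R]_1) :
  fractional_brownian_field P beta B -> 0 < beta -> 0 < u 0 0 ->
  unit_cube 1 s ->
  qm_norm P (fun w => B (map2_mx *%R u s) w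
       - bernoulli_mean s (fun e => B (map2_mx *%R u e) w)) ^+ 2 =
  u 0 0 `^ beta * interpolation_error beta (s 0 0).
Proof.
move=> fB b0 u0 s01; have := s01 0; rewrite in_itv/= => /andP[s0 s1].
have c0 (t : 'rV[R]_1) : 0 <= t 0 0 -> nonneg_orthant 1 t.
  by move=> t0 i; rewrite (ord1 i).
have us0 : nonneg_orthant 1 (map2_mx *%R u s).
  by apply: c0; rewrite mxE mulr_ge0// ltW.
have u00 : nonneg_orthant 1 (map2_mx *%R u 0) by apply: c0; rewrite !mxE mulr0.
have u10 : nonneg_orthant 1 (map2_mx *%R u (const_mx 1)).
  by apply: c0; rewrite !mxE mulr1 ltW.
rewrite qm_norm_sqrE; under eq_Rintegral do rewrite bernoulli_mean1.
rewrite second_moment_lin; try exact: (fbf_measurable fB);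
  try exact: (fbf_integrable fB).
rewrite !(fbf_moment fB)// /fbf_cov !euclidean_norm1 !mxE.
rewrite !mulr0 !mulr1 !subr0 !sub0r !subrr !normrN !normr0 !powR0 ?gt_eqF//.
have -> : u 0 0 * s 0 0 - u 0 0 = - (u 0 0 * (1 - s 0 0)) by ring.
rewrite normrN !normrM !ger0_norm ?subr_ge0 ?(ltW u0)//.
rewrite !powRM ?subr_ge0 ?(ltW u0)// /interpolation_error.
by field.
Qed.

Lemma ge0_integral_unit_cube1 (R : realType) (f : R -> \bar R) :
  measurable_fun (`[0, 1]%classic : set (measurableTypeR R)) f ->
  (forall x, x \in `[0, 1] -> (0 <= f x)%E) ->
  (\int[lebesgue_row 1]_(t in unit_cube 1) f (t 0%R 0%R) =
   \int[@lebesgue_measure R]_(x in `[0%R, 1%R]) f x)%E.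
Proof.
move=> mf f0.
have coordE (t : 'rV[R]_1) : unit_cube 1 t -> t 0 0 \in `[0, 1] by exact.
rewrite (ge0_integral_unit_cube ord0).
- apply: eq_integral => x _.
  rewrite (eq_integral (cst (f x))) => [|y _]; last by rewrite mxE unlift_none.
  rewrite integral_cst; last exact: measurable_unit_cube.
  by rewrite [X in (_ * X)%E]lebesgue_unit_cube mule1.
- apply: (measurable_comp _ _ mf) => //; first by move=> _ [t t01 <-]; exact: t01.
  exact: measurable_funTS (measurable_coord _).
- by move=> t t01; exact/f0/t01.
Qed.

(** The dimension is a variable [n] equal to [1], since it is [l j] in the
    application. Nonnegativity of [interpolation_error], needed for Tonelli's
    theorem, comes from its being a mean square. *)
Lemma fbf_error_dim1 (R : realType) (d : measure_display)
    (T : measurableType d) (P : probability T R) (beta : R) (n : nat)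
    (B : 'rV[R]_n -> T -> R) (u : 'rV[R]_n) (n1 : n = 1%N) (i : 'I_n) :
  fractional_brownian_field P beta B -> 0 < beta -> 0 < u 0 i ->
  fbf_error P B u = a_const beta * u 0 i `^ beta.
Proof.
subst n; rewrite (ord1 i) => fB b0 u0.
have ub0 : 0 < u 0 0 `^ beta by rewrite powR_gt0.
have eE s (s01 : unit_cube 1 s) := fbf_error_pointwise fB b0 u0 s01.
have ie := within01_integrable (within01_interpolation_error b0).
have e0 x : x \in `[0, 1] -> 0 <= interpolation_error beta x.
  move=> x01; rewrite -(pmulr_rge0 _ ub0).
  have c01 : unit_cube 1 (const_mx x : 'rV[R]_1) by move=> q; rewrite mxE.
  by have := eE _ c01; rewrite [(const_mx x) 0 0]mxE => <-; exact: sqr_ge0.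
rewrite -(Rintegral_interpolation_error b0) mulrC -RintegralZl//.
rewrite /fbf_error /Rintegral -ge0_integral_unit_cube1.
- by congr fine; apply: eq_integral => s /set_mem s01; rewrite eE.
- apply/measurable_EFinP; apply: measurable_funM; first exact: measurable_cst.
  by have /measurable_EFinP := measurable_int _ ie.
- by move=> x x01; rewrite lee_fin mulr_ge0 ?(ltW ub0)// e0.
Qed.

(** * Integrating out all coordinates but one *)

Section clamp.
Context {R : realType}.

Definition clamp (x : R) : R := Num.max 0 (Num.min 1 x).

Lemma clamp01 x : clamp x \in `[0, 1].
Proof. by rewrite in_itv/= /clamp le_max lexx/= ge_max ler01 ge_min lexx. Qed.

Lemma clamp_id x : x \in `[0, 1] -> clamp x = x.
Proof.
by rewrite in_itv/= /clamp => /andP[x0 x1]; rewrite min_r// max_r.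
Qed.

Lemma clamp_continuous : continuous clamp.
Proof.
move=> x; apply: continuous_max; first exact: cst_continuous.
by apply: continuous_min; [exact: cst_continuous|exact: cvg_id].
Qed.

(** A function continuous on the cube extends to a continuous function on the
    whole space by composition with the retraction onto the cube. *)
Lemma within_cube_clamp n (f : 'rV[R]_n -> R) :
  {within unit_cube n, continuous f} ->
  continuous (f \o map_mx clamp : 'rV[R]_n -> R).
Proof.
move=> cf; apply/continuous_subspace_setT.
apply: (within_continuous_comp _ _ cf); last first.
  by move=> y _ i; rewrite mxE; exact: clamp01.
apply: row_continuous => i y; under eq_fun do rewrite mxE.
apply: (continuous_comp (f := fun z : 'rV[R]_n => z 0 i)).
  exact: coord_continuous.
exact: clamp_continuous.
Qed.
End clamp.

Lemma map_clamp_id (R : realType) n (t : 'rV[R]_n) : unit_cube n t ->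
  map_mx clamp t = t.
Proof. by move=> t01; apply/rowP => i; rewrite mxE clamp_id. Qed.

Lemma unit_cube_compact (R : realType) n : compact (@unit_cube R n).
Proof.
apply: (@rV_compact R n (fun=> `[0, 1]%classic)) => _; exact: segment_compact.
Qed.

Lemma within_cube_measurable (R : realType) n (f : 'rV[R]_n -> R) :
  {within unit_cube n, continuous f} -> measurable_fun (unit_cube n) f.
Proof.
move=> /within_cube_clamp/continuous_measurable_row mf.
apply: (eq_measurable_fun (f \o map_mx clamp)).
  by move=> t /set_mem t01; rewrite /= map_clamp_id.
exact: measurable_funTS.
Qed.

Section slices.
Context {R : realType} {n : nat} (p : 'I_n) (c : 'rV[R]_n -> R).
Hypothesis cc : {within unit_cube n, continuous c}.
Hypothesis c0 : forall t, unit_cube n t -> 0 < c t.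

Let mu := @lebesgue_measure R.
Let ce : 'rV[R]_n -> R := c \o map_mx clamp.

Definition slice_integral (x : R) : R :=
  \int[lebesgue_row n.-1]_(y in unit_cube n.-1) c (insert p x y).

Let unit_cube_insert' x (y : 'rV[R]_n.-1) :
  x \in `[0, 1] -> unit_cube n.-1 y -> unit_cube n (insert p x y).
Proof.
by move=> x01 y01 i; rewrite mxE; case: unlift => [q|] //; exact: y01.
Qed.

Let cube0 : @unit_cube R n !=set0.
Proof. by exists (const_mx 0) => i; rewrite mxE in_itv/= lexx ler01. Qed.

Let ceE t : unit_cube n t -> ce t = c t.
Proof. by move=> t01; rewrite /ce/= map_clamp_id. Qed.

Let ce_bounds : exists m M : R, 0 < m /\ forall t, m <= ce t <= M.
Proof.
have c01 (y : 'rV[R]_n) : map_mx clamp y \in @unit_cube R n.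
  by apply/mem_set => i; rewrite mxE; exact: clamp01.
have [t t01 tmin] := EVT_min_rV cube0 (@unit_cube_compact R n) cc.
have [s s01 smax] := EVT_max_rV cube0 (@unit_cube_compact R n) cc.
exists (c t), (c s); split; first exact/c0/set_mem.
by move=> y; rewrite /ce/= tmin// smax.
Qed.

Let ce_slice_measurable x :
  measurable_fun setT (fun y : 'rV[R]_n.-1 => ce (insert p x y)).
Proof.
apply: continuous_measurable_row => y.
apply: (continuous_comp (f := fun z : 'rV[R]_n.-1 => insert p x z : 'rV[R]_n)).
  apply: row_continuous => i z; rewrite /insert; under eq_fun do rewrite mxE.
  by case: unlift => [q|]; [exact: coord_continuous|exact: cst_continuous].
exact: within_cube_clamp.
Qed.

Let ce_slice_continuous (y : 'rV[R]_n.-1) :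
  continuous (fun x => ce (insert p x y)).
Proof.
move=> x; apply: (continuous_comp (f := fun z : R => insert p z y : 'rV[R]_n)).
  apply: row_continuous => i z; rewrite /insert; under eq_fun do rewrite mxE.
  by case: unlift => [q|]; [exact: cst_continuous|exact: cvg_id].
exact: within_cube_clamp.
Qed.

Let nu := @lebesgue_row R n.-1.

Let cst_integrable (r : R) : nu.-integrable (unit_cube n.-1) (EFin \o cst r).
Proof.
apply/integrableP; split; first by apply/measurable_EFinP; exact: measurable_cst.
rewrite (eq_integral (cst `|r|%:E))// integral_cst; last first.
  exact: measurable_unit_cube.
by rewrite [X in (_ * X)%E]lebesgue_unit_cube mule1 ltry.
Qed.

Let ce_slice_integrable x :
  nu.-integrable (unit_cube n.-1) (EFin \o (fun y => ce (insert p x y))).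
Proof.
have [m [M [m0 mM]]] := ce_bounds.
apply: (@le_integrable _ _ _ nu _ (@measurable_unit_cube _ _) _
  (EFin \o cst M)); last exact: cst_integrable.
  apply/measurable_EFinP; exact: measurable_funTS (ce_slice_measurable x).
move=> y _ /=; have /andP[mc cM] := mM (insert p x y).
rewrite lee_fin !ger0_norm// (le_trans (ltW m0))//.
exact: le_trans cM.
Qed.

Let sliceE x : x \in `[0, 1] -> slice_integral x =
  \int[nu]_(y in unit_cube n.-1) ce (insert p x y).
Proof.
move=> x01; apply: eq_Rintegral => y /set_mem y01.
by rewrite ceE//; exact: unit_cube_insert'.
Qed.

Lemma slice_integral_gt0 x : x \in `[0, 1] -> 0 < slice_integral x.
Proof.
move=> x01; rewrite sliceE//; have [m [M [m0 mM]]] := ce_bounds.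
apply: (lt_le_trans m0).
have -> : m = \int[nu]_(y in unit_cube n.-1) m.
  rewrite Rintegral_cst ?[X in fine X]lebesgue_unit_cube ?mulr1//.
  exact: measurable_unit_cube.
apply: le_Rintegral.
- exact: measurable_unit_cube.
- exact: cst_integrable.
- exact: ce_slice_integrable.
by move=> y _; have /andP[] := mM (insert p x y).
Qed.

(** Dominated convergence, applied to the extension of [c] in order to have an
    open interval around [[0, 1]] to work in. *)
Lemma slice_integral_continuous : {within `[0, 1], continuous slice_integral}.
Proof.
have [m [M [m0 mM]]] := ce_bounds.
have cI : {in `](-1), 2[%classic, continuous (fun x : R =>
    \int[nu]_(y in unit_cube n.-1) ce (insert p x y))}.
  apply: (continuity_under_integral (@measurable_unit_cube R n.-1)
    (u := -1) (v := 2) _ _ (cst_integrable M)).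
  - by move=> x _; exact: ce_slice_integrable.
  - by apply: aeW => y _ x _; exact: ce_slice_continuous.
  - move=> x _; apply: aeW => y _; have /andP[mc cM] := mM (insert p x y).
    by rewrite ger0_norm// (le_trans (ltW m0)).
apply: (@subspace_eq_continuous _ _ _ (fun x : R =>
    \int[nu]_(y in unit_cube n.-1) ce (insert p x y))).
  by move=> x /set_mem x01; rewrite /from_subspace/= sliceE.
apply: continuous_in_subspaceT => x /set_mem; rewrite /= in_itv/= => /andP[x0 x1].
by apply: cI; apply/mem_set; rewrite /= in_itv/=; apply/andP; split; lra.
Qed.

Lemma Rintegral_unit_cube_slice (phi : R -> R) :
  measurable_fun (`[0, 1]%classic : set (measurableTypeR R)) phi ->
  (forall x, x \in `[0, 1] -> 0 <= phi x) ->
  \int[lebesgue_row n]_(t in unit_cube n) (c t * phi (t 0 p)) =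
  \int[mu]_(x in `[0, 1]) (slice_integral x * phi x).
Proof.
move=> mphi phi0; rewrite /Rintegral; congr fine.
have mcphi : measurable_fun (unit_cube n) (fun t => (c t * phi (t 0 p))%:E).
  apply/measurable_EFinP; apply: measurable_funM.
    exact: within_cube_measurable.
  apply: (measurable_comp _ _ mphi) => //; first by move=> _ [t t01 <-]; exact: t01.
  exact: measurable_funTS (measurable_coord p).
have cphi0 t : unit_cube n t -> (0 <= (c t * phi (t 0%R p))%:E)%E.
  by move=> t01; rewrite lee_fin mulr_ge0 ?(ltW (c0 t01))// phi0//; exact: t01.
transitivity (\int[mu]_(x in `[0%R, 1%R]) \int[nu]_(y in unit_cube n.-1)
    (c (insert p x y) * phi (insert p x y 0%R p))%:E)%E.
  rewrite /nu; move: mcphi cphi0; clear.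
  case: n p c => [[]//|m q f] mcphi cphi0 /=.
  exact: (ge0_integral_unit_cube q mcphi cphi0).
apply: eq_integral => x /set_mem x01.
rewrite (eq_integral (fun y => (phi x)%:E * (ce (insert p x y))%:E))%E; last first.
  move=> y /set_mem y01; rewrite -EFinM ceE; last exact: unit_cube_insert'.
  by rewrite mulrC [in LHS]mxE unlift_none.
rewrite integralZl; [|exact: measurable_unit_cube|exact: ce_slice_integrable].
rewrite EFinM muleC; congr (_ * _)%E; rewrite sliceE// /Rintegral fineK//.
apply: integrable_fin_num; first exact: measurable_unit_cube.
exact: ce_slice_integrable.
Qed.
End slices.

(** * The coefficient of a one-dimensional component *)

Lemma powR_inv (R : realType) (x b : R) : 0 < x -> x^-1 `^ b = x `^ (- b).
Proof. by move=> x0; rewrite -powR_inv1 ?ltW// -powRrM mulN1r. Qed.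

Lemma a_const_gt0 (R : realType) (b : R) : 0 < b < 2 -> 0 < a_const b.
Proof.
move=> /andP[b0 b2]; rewrite /a_const subr_gt0 ltr_pdivlMr; last first.
  by apply: mulr_gt0; lra.
by rewrite mulrC ltr_pdivrMr//; nra.
Qed.

Theorem proposition1 (R : realType)
    (d : measure_display) (Omega : measurableType d) (P : probability Omega R)
    (k : nat) (l : 'I_k -> nat) (l_gt0 : forall j, (0 < l j)%N)
    (alpha : 'I_k -> R) (alpha02 : forall j, 0 < alpha j < 2)
    (c : 'I_k -> 'rV[R]_(total_dim l) -> R) (X : 'rV[R]_(total_dim l) -> Omega -> R)
    (X_ls : locally_stationary P alpha c X)
    (h : 'I_k -> R -> R) (h_density : forall j, pos_cont_density (h j))
    (sizes : set nat) (sizes_inf : infinite_set sizes)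
    (sizes_gt0 : forall N, sizes N -> (0 < N)%N)
    (n : nat -> 'I_k -> nat)
    (n_gt0 : forall N, sizes N -> forall j, (0 < n N j)%N)
    (n_prod : forall N, sizes N -> (\prod_j (n N j).+1 ^ l j)%N = N)
    (n_infty : forall j, n N j @[N --> within sizes \oo] --> \oo)
    (tau : nat -> 'I_(total_dim l) -> nat -> R) (design : nat -> set 'rV[R]_(total_dim l))
    (design_cRS : forall N, sizes N ->
       cross_regular h (n N) (tau N) (design N))
    (XN : nat -> 'rV[R]_(total_dim l) -> Omega -> R)
    (XN_MPLI : forall N, sizes N -> MPLI (n N) (tau N) X (XN N))
    (j : 'I_k) (lj1 : l j = 1%N)
    (e : measure_display) (W : measurableType e) (Q : probability W R)
    (B : 'rV[R]_(l j) -> W -> R)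
    (B_fbf : fractional_brownian_field Q (alpha j) B) :
  let v := error_coef Q c B in
  let C := integrated_ls l_gt0 c j in
  let gamma := 1 / (1 + alpha j) in
  let h_opt := opt_density gamma C in
  [/\ forall g, pos_cont_density g ->
        v g = a_const (alpha j) *
          \int[lebesgue_measure]_(x in `[0, 1]) (C x * g x `^ (- alpha j)),
      pos_cont_density h_opt,
      forall g, pos_cont_density g ->
        v h_opt <= v g /\
        (v g = v h_opt -> forall x, x \in `[0, 1] -> g x = h_opt x) &
      v h_opt = a_const (alpha j) * gamma_norm gamma C].
Proof.
move=> v C gamma h_opt; have [_ c_cont _ _] := X_ls.
have [cc c0] := c_cont j; have a0 : 0 < alpha j by have /andP[] := alpha02 j.
have K0 : 0 < a_const (alpha j) by exact: a_const_gt0.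
pose p := tagnat.Rank j (last_ord (l_gt0 j)).
have cC : {within `[0, 1], continuous C} := slice_integral_continuous (p := p) cc c0.
have C0 x : x \in `[0, 1] -> 0 < C x := @slice_integral_gt0 _ _ p _ cc c0 x.
have vE g : pos_cont_density g -> v g = a_const (alpha j) *
    \int[lebesgue_measure]_(x in `[0, 1]) (C x * g x `^ (- alpha j)).
  move=> [cg g0 _].
  have cga := within01_powR (b := - alpha j) cg g0.
  (* the vector of reciprocals of [g] has the single entry [1 / g (t_p)] *)
  transitivity (\int[lebesgue_row (total_dim l)]_(t in unit_cube (total_dim l))
      (c j t * (a_const (alpha j) * g (t 0 p) `^ (- alpha j)))).
    apply: eq_Rintegral => t /set_mem t01; congr (_ * _).
    have gp : 0 < g (t 0 p) by apply: g0; exact: t01.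
    rewrite (fbf_error_dim1 lj1 (i := last_ord (l_gt0 j)) B_fbf a0) !mxE ?invr_gt0//.
    by rewrite powR_inv.
  rewrite (Rintegral_unit_cube_slice p cc c0
    (phi := fun x => a_const (alpha j) * g x `^ (- alpha j))).
  - rewrite -RintegralZl//; last exact/within01_integrable/within01_mul.
    by apply: eq_Rintegral => x _; rewrite -[slice_integral _ _ x]/(C x); ring.
  - apply: measurable_funM; first exact: measurable_cst.
    by have /measurable_EFinP := measurable_int _ (within01_integrable cga).
  - by move=> x _; rewrite mulr_ge0 ?powR_ge0// ltW.
have dh : pos_cont_density h_opt by exact: opt_density_pos_cont.
split; [exact: vE|exact: dh|move=> g dg; rewrite (vE _ dg) (vE _ dh)|].
- split; first by rewrite (ler_pM2l K0); exact: opt_density_min.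
  by move=> /(mulfI (lt0r_neq0 K0)); exact: opt_density_unique.
- rewrite (vE _ dh); congr (_ * _).
  have gammaV : gamma^-1 = 1 + alpha j by rewrite /gamma div1r invrK.
  by rewrite /gamma_norm gammaV; exact: (opt_density_value a0 cC C0).
Qed.
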